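(* Let $R_n(x)$ be the Ramanujan polynomials. Then for $n\ge 1$, $$R_{n+1}(x)=\sum_{T\in\mathrm{SYT}(n)}\prod_{i=1}^n\sigma_i(T)\left(\sum_{j=0}^i\binom ij j!\,x^j\right)^{w_i(T)},$$ where $w_i(T)$ is the number of rows in $T$ with $i$ elements and $\sigma_i(T)$ is the box sorting index of $i$.
   Context: The Ramanujan polynomials are defined by $R_1(x)=1$ and $R_{n+1}(x)=n(1+x)R_n(x)+x^2\frac{\mathrm d}{\mathrm dx}R_n(x)$ for $n\ge1$. A standard Young tableau of size $n$ is a filling of the Ferrers diagram of a partition $\lambda\vdash n$ (French convention: left-justified rows numbered from bottom to top, $\lambda_i$ boxes in row $i$) with $1,\dots,n$, each used exactly once, increasing from left to right in rows and from bottom to top in columns; $\mathrm{SYT}(n)$ is the set of all of them, over all $\lambda\vdash n$. For $T\in\mathrm{SYT}(n)$, $T_i$ is the tableau obtained from $T$ by deleting the entries $i+1,\dots,n$, and $\mathrm{col}_k(T_i)$ is the number of boxes in the $k$-th column of $T_i$. The box sorting index of $i$ is $$\sigma_i(T)=\begin{cases} i-\mathrm{col}_1(T_i)+1, & \text{if } i \text{ is in the first column of } T,\\ \mathrm{col}_k(T_i)-\mathrm{col}_{k+1}(T_i)+1, & \text{if } i \text{ is in the } (k+1)\text{-th column of } T,\ k\ge1.\end{cases}$$ *)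

(* Defs.v *)
From HB Require Import structures.
From mathcomp Require Import all_boot all_order all_algebra.

Set Implicit Arguments.
Unset Strict Implicit.
Unset Printing Implicit Defensive.

Import GRing.Theory.
Local Open Scope ring_scope.

(* The indexing starts at 1; the value at 0 is a dummy (the recurrence does not
   extend to it). *)
Fixpoint ramanujan (n : nat) : {poly int} :=
  match n with
  | 0 => 0
  | m.+1 => if m is 0 then 1
            else m%:R * (1 + 'X) * ramanujan m + 'X^2 * (ramanujan m)^`()
  end.

(* A partition of n, padded with zeros to exactly n parts. *)
Definition is_partition (n : nat) (lam : {ffun 'I_n -> 'I_n.+1}) : bool :=
  [forall r : 'I_n, forall s : 'I_n, (r <= s)%N ==> (lam s <= lam r)%N]
  && (\sum_(r < n) (lam r : nat) == n)%N.

(* A partial filling of the n x n grid by 1, ..., n, where the value 0 means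
   "no box here". In T (r, c), r is the row counted from the bottom and c the
   column counted from the left, both starting at 0. The Ferrers diagram of
   every partition of n fits in this grid. *)
Definition filling (n : nat) := {ffun 'I_n * 'I_n -> 'I_n.+1}.

Definition box (n : nat) (T : filling n) (p : 'I_n * 'I_n) : bool :=
  (T p != 0 :> nat)%N.

Definition has_shape (n : nat) (lam : {ffun 'I_n -> 'I_n.+1})
    (T : filling n) : bool :=
  [forall r : 'I_n, forall c : 'I_n, box T (r, c) == (c < lam r)%N].

Definition each_once (n : nat) (T : filling n) : bool :=
  [forall v : 'I_n.+1, (0 < v)%N ==> (#|[set p | T p == v]| == 1)%N].

Definition rows_increasing (n : nat) (T : filling n) : bool :=
  [forall r : 'I_n, forall c : 'I_n, forall c' : 'I_n,
    [&& (c < c')%N, box T (r, c) & box T (r, c')]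
      ==> (T (r, c) < T (r, c'))%N].

Definition cols_increasing (n : nat) (T : filling n) : bool :=
  [forall c : 'I_n, forall r : 'I_n, forall r' : 'I_n,
    [&& (r < r')%N, box T (r, c) & box T (r', c)]
      ==> (T (r, c) < T (r', c))%N].

Definition SYT (n : nat) : {set filling n} :=
  [set T : filling n |
    [&& [exists lam : {ffun 'I_n -> 'I_n.+1},
           is_partition lam && has_shape lam T],
        each_once T, rows_increasing T & cols_increasing T]].

(* T_i: the entries larger than i are deleted together with their boxes. *)
Definition truncate (n : nat) (T : filling n) (i : nat) : filling n :=
  [ffun p => if (T p <= i)%N then T p else ord0].

(* Columns are numbered from 1 in [col_len] and [column_of]. *)
Definition col_len (n : nat) (T : filling n) (k : nat) : nat :=
  #|[set p : 'I_n * 'I_n | box T p & (p.2.+1 == k)%N]|.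

(* The dummy value 0 is taken only when i is not an entry of T. *)
Definition column_of (n : nat) (T : filling n) (i : nat) : nat :=
  if [pick p : 'I_n * 'I_n | box T p & (T p == i :> nat)%N] is Some p
  then p.2.+1 else 0%N.

(* Differences are taken in int, so that they are not truncated. *)
Definition sigma (n : nat) (T : filling n) (i : nat) : int :=
  let Ti := truncate T i in
  match column_of T i with
  | k'.+2 => let k := k'.+1 in (col_len Ti k)%:Z - (col_len Ti k.+1)%:Z + 1
  | 1%N => i%:Z - (col_len Ti 1%N)%:Z + 1
  | 0%N => 0
  end.

Definition row_len (n : nat) (T : filling n) (r : 'I_n) : nat :=
  #|[set c : 'I_n | box T (r, c)]|.

Definition w (n : nat) (T : filling n) (i : nat) : nat :=
  #|[set r : 'I_n | row_len T r == i]|.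

(* Main.v *)
Require Import Defs.
From mathcomp Require Import all_boot all_fingroup all_order all_algebra.
From mathcomp Require Import zify ring.
Import GRing.Theory.
Local Open Scope ring_scope.

(** The idea is to read the Ramanujan recurrence as the rule for adding one box
    to a tableau. Put f_k = \sum_j 'C(k, j) j! x^j. Then f_0 = 1, f_1 = 1 + x and

      x^2 f_k' = f_(k+1) - (1 + x) f_k                  ([deriv_ffact_poly]).

    For a tableau T of size k with row lengths lam_1, lam_2, ..., let F(T) be
    the product of the f_(lam_r). Powers of f_i counted by the numbers of rows
    with i boxes give the same product ([prod_ffact_poly_w]). If T has l
    nonempty rows, Leibniz' rule shows that x^2 F(T)' + (k + 1) (1 + x) F(T) is
    the sum over the nonempty rows r of the product in which lam_r has become
    lam_r + 1, plus (k + 1 - l) (1 + x) F(T).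

    On the other hand, the tableaux of size k + 1 whose truncation is T are
    obtained by adding the box of k + 1 at an addable corner
    ([sum_tableau_upto]), and there is one such corner for each row length
    that occurs, and one in the first column. The box sorting index of k + 1 is
    the number of rows of T of that length, respectively k + 1 - l
    ([sigma_extend_last]), while those of the smaller entries do not change.
    Hence the weighted sum of F over these tableaux is the expression above
    ([sum_addable_weight]). Summing over T, the sum for size k + 1 arises
    from that for size k by the Ramanujan recurrence ([tableau_sumS]), and for
    size 0 it is 1.

    All sizes k <= n are treated inside the n x n grid. Since f_0 = 1, products
    over all n rows of the grid may be used, empty rows included. *)

(** * The polynomials attached to row lengths *)

Definition ffact_poly (k : nat) : {poly int} :=
  \sum_(0 <= j < k.+1) ('C(k, j) * j`!)%:R *: 'X^j.

Lemma ffact_poly0 : ffact_poly 0 = 1.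
Proof. by rewrite /ffact_poly big_nat1 bin0 mul1n scale1r. Qed.

Lemma ffact_polyS k :
  ffact_poly k.+1 = 1 + k.+1%:R * 'X * ffact_poly k.
Proof.
rewrite /ffact_poly big_nat_recl // bin0 mul1n scale1r expr0; congr (_ + _).
rewrite mulr_sumr; apply: eq_bigr => j _.
rewrite !bin_ffact ffactSS natrM -scalerA exprS scaler_nat -!mulrA.
by rewrite mulr_natl -!scalerAr.
Qed.

(** The identity that drives the proof: the operator x^2 d/dx lengthens a row
    by one box, up to a multiple of the row it started from. It also holds at
    k = 0, which is what lets empty rows be treated like the others. *)
Lemma deriv_ffact_poly k :
  'X^2 * (ffact_poly k)^`() = ffact_poly k.+1 - (1 + 'X) * ffact_poly k.
Proof.
elim: k => [|k IHk].
  by rewrite ffact_polyS ffact_poly0 derivC mulr0 !mulr1 mul1r subrr.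
rewrite [in LHS]ffact_polyS derivD derivC add0r -mulrA mulr_natl derivMn.
rewrite derivM derivX mul1r.
have -> : 'X^2 * ((ffact_poly k + 'X * (ffact_poly k)^`()) *+ k.+1) =
  k.+1%:R * 'X * ('X * ffact_poly k + 'X^2 * (ffact_poly k)^`()).
  by rewrite -mulr_natl; ring.
by rewrite IHk (ffact_polyS k.+1) ffact_polyS; ring.
Qed.

Lemma deriv_prod (I : finType) (F : I -> {poly int}) :
  (\prod_i F i)^`() = \sum_i (F i)^`() * \prod_(j | j != i) F j.
Proof.
suff H (r : seq I) : uniq r -> (\prod_(i <- r) F i)^`() =
    \sum_(i <- r) (F i)^`() * \prod_(j <- r | j != i) F j.
  exact: H (index_enum_uniq I).
elim: r => [|i r IHr] /=; first by rewrite !big_nil derivC.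
case/andP=> ir /IHr{}IHr; rewrite !big_cons derivM IHr eqxx /=; congr (_ * _ + _).
  rewrite big_seq [RHS]big_seq_cond; apply: eq_bigl => j.
  by case: (boolP (j \in r)) => //= jr; apply/esym; apply: contraNneq ir => <-.
rewrite mulr_sumr !big_seq; apply: eq_bigr => j jr.
rewrite big_cons ifT; first by rewrite mulrCA.
by apply: contraNneq ir => ->.
Qed.

Definition grow {n : nat} (lam : 'I_n -> nat) (r : 'I_n) : 'I_n -> nat :=
  fun s => (lam s + (s == r))%N.

Definition row_prod {n : nat} (lam : 'I_n -> nat) : {poly int} :=
  \prod_r ffact_poly (lam r).

(** Leibniz' rule turns x^2 d/dx on a product over rows into the sum over all
    ways to lengthen one of the n rows, where empty rows count as well. *)
Lemma deriv_row_prod n (lam : 'I_n -> nat) :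
  'X^2 * (row_prod lam)^`() =
    \sum_r row_prod (grow lam r) - n%:R * (1 + 'X) * row_prod lam.
Proof.
rewrite /row_prod deriv_prod mulr_sumr.
have -> : n%:R * (1 + 'X) * (\prod_r ffact_poly (lam r)) =
    \sum_(r < n) ((1 + 'X) * \prod_r ffact_poly (lam r)) :> {poly int}.
  by rewrite sumr_const card_ord -mulrA mulr_natl.
rewrite -sumrB; apply: eq_bigr => r _.
rewrite [X in _ = X - _](bigD1 r) //= [X in _ = _ - _ * X](bigD1 r) //=.
rewrite mulrA deriv_ffact_poly /grow eqxx addn1.
have -> : \prod_(s | s != r) ffact_poly (lam s + (s == r))
        = \prod_(s | s != r) ffact_poly (lam s).
  by apply: eq_bigr => s /negbTE->; rewrite addn0.
by ring.
Qed.

(** Lengthening either of two equally long rows gives the same multiset of row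
    lengths: exchanging the two rows maps one product to the other. *)
Lemma row_prod_grow n (lam : 'I_n -> nat) r s :
  lam r = lam s -> row_prod (grow lam r) = row_prod (grow lam s).
Proof.
move=> rs; rewrite /row_prod (reindex_inj (@perm_inj _ (tperm r s))) /grow.
apply: eq_bigr => t _; congr (ffact_poly (_ + _)); first by case: tpermP => // ->.
by rewrite -[in X in _ == X](tpermR r s) (inj_eq perm_inj).
Qed.

(** * Equal rows grouped together *)

(** In the weakly decreasing sequence of row lengths of a tableau, a box can be
    added precisely to the first row of each length. *)
Definition first_row {n : nat} (lam : 'I_n -> nat) (r : 'I_n) : bool :=
  [forall s : 'I_n, (s < r)%N ==> (lam s != lam r)].

Definition multiplicity {n : nat} (lam : 'I_n -> nat) (c : nat) : nat :=
  #|[set r | lam r == c]|.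

(** Equally long rows contribute equally to a sum over all rows, so the sum can
    be taken over one representative of each length, counted with
    multiplicity. These multiplicities are the box sorting indices, apart from
    the first column. *)
Lemma sum_first_row (V : nmodType) n (lam : 'I_n -> nat) (h : 'I_n -> V) :
    (forall r s, lam r = lam s -> h r = h s) ->
  \sum_r h r = \sum_(r | first_row lam r) h r *+ multiplicity lam (lam r).
Proof.
move=> hE.
pose first s := [arg min_(t < s | lam t == lam s) (t : nat)].
have firstP s : first_row lam (first s) /\ lam (first s) = lam s.
  rewrite /first; case: arg_minnP => // t /eqP ts tmin; split=> //.
  apply/forallP=> u; apply/implyP; apply: contraTneq => ut.
  by rewrite -leqNgt tmin // ut ts.
rewrite (partition_big first (first_row lam)); last by move=> s _; case: (firstP s).
apply: eq_bigr => r /forallP r1.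
have eq_first s : (first s == r) = (lam s == lam r).
  apply/eqP/eqP=> [<-|sr]; first by case: (firstP s).
  have [/forallP s1 ss] := firstP s; apply/val_inj/eqP.
  have := r1 (first s); rewrite ss sr eqxx implybF -leqNgt eqn_leq => ->.
  by have := s1 r; rewrite ss sr eqxx implybF -leqNgt => ->.
rewrite (eq_bigl _ _ eq_first) /multiplicity cardsE -sumr_const.
by apply: eq_big => // s /eqP /hE.
Qed.

Lemma sum_first_row_eq (V : nmodType) n (lam : 'I_n -> nat) c (x : V) :
  (exists r, lam r = c) -> \sum_(r | first_row lam r && (lam r == c)) x = x.
Proof.
case=> r0 /eqP r0c.
case: (@arg_minnP _ r0 (fun r => lam r == c) (fun r => r) r0c) => r /eqP rc rmin.
apply: (big_pred1 r) => s; apply/andP/eqP=> [[/forallP s1 /eqP sc]|->].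
  apply/val_inj/eqP; rewrite eqn_leq rmin ?sc // andbT.
  by have := s1 r; rewrite rc sc eqxx implybF -leqNgt.
split; last exact/eqP.
apply/forallP=> t; apply/implyP; apply: contraTneq => tc.
by rewrite -leqNgt rmin // tc rc.
Qed.

(** * Tableaux with entries up to k inside a fixed grid *)

Lemma card_set_sum (I : finType) (P : pred I) :
  #|[set i | P i]| = (\sum_i P i)%N.
Proof.
rewrite cardsE -sum1_card big_mkcond; apply: eq_bigr => i _.
by rewrite unfold_in; case: (P i).
Qed.

Lemma initial_segment n (P : pred 'I_n) (c : 'I_n) :
    (forall i j : 'I_n, (i <= j)%N -> P j -> P i) ->
  P c = (c < #|[set i | P i]|)%N.
Proof.
have card_lt m : (m <= n)%N -> #|[set i : 'I_n | (i < m)%N]| = m.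
  move=> mn; rewrite cardsE -sum1_card -(big_ord_widen _ (fun=> 1%N)) //.
  by rewrite sum1_card card_ord.
move=> Pdown; apply/idP/idP=> [Pc|].
  rewrite -[X in (X <= _)%N]card_lt //; apply/subset_leq_card/subsetP=> i.
  by rewrite !inE ltnS => /Pdown->.
apply: contraLR => nPc; rewrite -leqNgt.
rewrite -[X in (_ <= X)%N]card_lt; last exact: ltnW.
apply/subset_leq_card/subsetP=> i; rewrite !inE ltnNge; apply: contraL => ci.
by apply: contra nPc => /Pdown->.
Qed.

Definition southwest {n : nat} (q p : 'I_n * 'I_n) : bool :=
  (q.1 <= p.1)%N && (q.2 <= p.2)%N.

(** The standard tableaux of size k drawn in the n x n grid, so that tableaux
    of different sizes have the same type and k can be the induction variable.
    The shape condition and both monotonicity conditions are merged into one: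
    every cell weakly south-west of a box is a box, with an entry that is not
    larger. Strict growth follows since no entry is repeated. *)
Definition tableau_upto {n : nat} (k : nat) (T : filling n) : bool :=
  [forall p, forall q, southwest q p && box T p ==> box T q && (T q <= T p)%N]
  && [forall v : 'I_n.+1, (0 < v)%N ==> (#|[set p | T p == v]| == (v <= k) :> nat)%N].

Lemma tableau_uptoP n k (T : filling n) :
  reflect ((forall p q, southwest q p -> box T p -> box T q && (T q <= T p)%N)
           /\ (forall v : 'I_n.+1, (0 < v)%N -> #|[set p | T p == v]| = (v <= k)%N))
          (tableau_upto k T).
Proof.
apply: (iffP andP) => -[H1 H2]; split.
- move=> p q qp Tp; move/forallP/(_ p)/forallP/(_ q)/implyP: H1; apply.
  exact/andP.
- by move=> v v0; apply/eqP; move/forallP/(_ v)/implyP: H2; apply.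
- by apply/forallP=> p; apply/forallP=> q; apply/implyP=> /andP[]; apply: H1.
- by apply/forallP=> v; apply/implyP=> v0; apply/eqP; apply: H2.
Qed.

Section TableauUpto.
Variables (n k : nat) (T : filling n).
Hypothesis tabT : tableau_upto k T.

Lemma tableau_down p q : southwest q p -> box T p -> box T q && (T q <= T p)%N.
Proof. by case/tableau_uptoP: tabT => H _; apply: H. Qed.

Lemma tableau_fibre (v : 'I_n.+1) :
  (0 < v)%N -> #|[set p | T p == v]| = (v <= k)%N.
Proof. by case/tableau_uptoP: tabT => _; apply. Qed.

Lemma tableau_entry_le p : (T p <= k)%N.
Proof.
rewrite leqNgt; apply/negP => kT.
have := tableau_fibre (T p) (leq_ltn_trans (leq0n k) kT).
rewrite leqNgt kT /= => /eqP; rewrite cards_eq0 => /eqP/setP/(_ p).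
by rewrite !inE eqxx.
Qed.

Lemma tableau_entry_inj p q : box T p -> T p = T q -> p = q.
Proof.
move=> Tp pq.
have /eqP := tableau_fibre (T p) ltac:(by rewrite lt0n).
rewrite tableau_entry_le => /cards1P[s /setP Es].
by move: (Es p) (Es q); rewrite !inE -pq eqxx => /esym/eqP-> /esym/eqP->.
Qed.

Lemma box_row_len r c : box T (r, c) = (c < row_len T r)%N.
Proof.
apply: (initial_segment n (fun c => box T (r, c))) => i j ij Tj.
by have /andP[] := tableau_down (r, j) (r, i) ltac:(by rewrite /southwest leqnn //) Tj.
Qed.

Lemma row_len_antitone (r s : 'I_n) : (r <= s)%N -> (row_len T s <= row_len T r)%N.
Proof.
move=> rs; apply/subset_leq_card/subsetP=> c; rewrite !inE => Ts.
by have /andP[] := tableau_down (s, c) (r, c) ltac:(by rewrite /southwest /= rs leqnn) Ts.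
Qed.

(** The boxes are counted by their entries: each of 1, ..., k occurs once. *)
Lemma card_box : (k <= n)%N -> #|[set p | box T p]| = k.
Proof.
move=> kn; rewrite cardsE -sum1_card.
rewrite (partition_big T (fun v => (0 < v)%N)); last first.
  by move=> p; rewrite unfold_in /box lt0n.
transitivity (\sum_(v < n.+1 | (0 < v)%N) (v <= k)%N)%N.
  apply: eq_bigr => v v0; rewrite -(tableau_fibre v) // cardsE -sum1_card.
  apply: eq_bigl => p; rewrite -[RHS]/(T p == v) unfold_in /box.
  by case: (T p =P v) => [->|_]; rewrite ?andbF // -lt0n v0.
rewrite big_mkcond big_ord_recl /= add0n.
transitivity (\sum_(i < n) (i < k))%N; first by apply: eq_bigr.
rewrite -(big_mkord xpredT (fun i => (i < k)%N : nat)) (big_cat_nat (leq0n k) kn) /=.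
rewrite [X in (_ + X)%N]big1_seq ?addn0; last first.
  by move=> i; rewrite mem_index_iota /= => /andP[ki _]; rewrite ltnNge ki.
rewrite big_nat; under eq_bigr => i /andP[_ ->] do [].
by rewrite -big_nat sum_nat_const_nat subn0 muln1.
Qed.

Lemma sum_row_len : (k <= n)%N -> (\sum_(r < n) row_len T r = k)%N.
Proof.
move=> kn; rewrite -[RHS]card_box // card_set_sum.
rewrite (eq_bigr (fun r => \sum_c box T (r, c))%N).
  by rewrite pair_bigA; apply: eq_bigr => -[].
by move=> r _; rewrite /row_len card_set_sum.
Qed.

Lemma row_len_le r : (k <= n)%N -> (row_len T r <= k)%N.
Proof.
by move=> kn; rewrite -[X in (_ <= X)%N](sum_row_len kn) (bigD1 r) //= leq_addr.
Qed.

(** With n nonempty rows there would be at least n > k boxes. *)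
Lemma exists_empty_row : (k < n)%N -> exists r, row_len T r = 0%N.
Proof.
move=> kn; case: (boolP [exists r, row_len T r == 0%N]) => [/existsP[r /eqP]|].
  by exists r.
rewrite negb_exists => /forallP pos; exfalso.
suff : (n <= k)%N by rewrite leqNgt kn.
rewrite -(sum_row_len (ltnW kn)) -[X in (X <= _)%N]card_ord -sum1_card.
by apply: leq_sum => r _; rewrite lt0n.
Qed.

End TableauUpto.

Lemma SYT_tableau_upto n (T : filling n) : (T \in SYT n) = tableau_upto n T.
Proof.
rewrite inE; apply/and4P/idP.
  case=> /existsP[lam /andP[/andP[/forallP lamP _] /forallP shape]] once rowT colT.
  have boxE r c : box T (r, c) = (c < lam r)%N by have /forallP/(_ c)/eqP := shape r.
  apply/tableau_uptoP; split; last first.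
    move=> v v0; rewrite -ltnS ltn_ord; apply/eqP.
    by move/forallP/(_ v)/implyP: once; apply.
  move=> [r c] [r' c']; rewrite /southwest /= => /andP[rr cc] Trc.
  have Tr'c : box T (r', c).
    move: Trc; rewrite !boxE => /leq_trans; apply.
    by have /forallP/(_ r)/implyP := lamP r'; apply.
  have Tr'c' : box T (r', c') by move: Tr'c; rewrite !boxE; apply: leq_ltn_trans.
  rewrite Tr'c'; apply: (@leq_trans (T (r', c))).
    case: ltngtP cc => // [cc _|/val_inj-> //].
    move/forallP/(_ r')/forallP/(_ c')/forallP/(_ c)/implyP: rowT => row.
    by apply/ltnW/row/and3P.
  case: ltngtP rr => // [rr _|/val_inj-> //].
  move/forallP/(_ c)/forallP/(_ r')/forallP/(_ r)/implyP: colT => col.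
  by apply/ltnW/col/and3P.
move=> tabT.
have ltT p q : southwest q p -> q != p -> box T p -> (T q < T p)%N.
  move=> qp neq Tp; have /andP[Tq] := tableau_down n n T tabT p q qp Tp.
  rewrite leq_eqVlt => /orP[/eqP/val_inj E|//].
  by rewrite (tableau_entry_inj n n T tabT q p Tq E) eqxx in neq.
have lenE r : ([ffun r => inord (row_len T r)] : {ffun 'I_n -> 'I_n.+1}) r
    = row_len T r :> nat.
  by rewrite ffunE inordK // ltnS (row_len_le n n T).
split.
- apply/existsP; exists [ffun r => inord (row_len T r)].
  apply/andP; split; [apply/andP; split|].
  + apply/forallP=> r; apply/forallP=> s; apply/implyP=> rs.
    by rewrite !lenE (row_len_antitone n n).
  + by rewrite -[X in _ == X](sum_row_len n n T tabT) //; apply/eqP/eq_bigr.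
  + apply/forallP=> r; apply/forallP=> c.
    by rewrite lenE (box_row_len n n).
- apply/forallP=> v; apply/implyP=> v0.
  by rewrite (tableau_fibre n n) // -ltnS ltn_ord.
- apply/forallP=> r; apply/forallP=> c; apply/forallP=> c'; apply/implyP.
  case/and3P=> cc _ Tp; apply: ltT => //; rewrite /southwest /= ?leqnn ?(ltnW cc) //.
  by rewrite xpair_eqE eqxx /= neq_ltn cc.
- apply/forallP=> c; apply/forallP=> r; apply/forallP=> r'; apply/implyP.
  case/and3P=> cc _ Tp; apply: ltT => //; rewrite /southwest /= ?leqnn ?(ltnW cc) //.
  by rewrite xpair_eqE eqxx andbT neq_ltn cc.
Qed.

(** * Adding the box of the largest entry *)

Definition addable {n : nat} (T : filling n) (p : 'I_n * 'I_n) : bool :=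
  ~~ box T p && [forall q, southwest q p && (q != p) ==> box T q].

Definition extend {n : nat} (k : nat) (T : filling n) (p : 'I_n * 'I_n) : filling n :=
  [ffun q => if q == p then inord k.+1 else T q].

Lemma truncate_tableau n k (T : filling n) :
  tableau_upto k.+1 T -> tableau_upto k (truncate T k).
Proof.
move=> tabT; apply/tableau_uptoP; split.
  move=> p q qp; rewrite /box !ffunE; case: leqP => // Tpk Tp.
  have /andP[Tq qTp] := tableau_down n k.+1 T tabT p q qp Tp.
  by rewrite (leq_trans qTp Tpk) qTp andbT.
move=> v v0; case: (leqP v k) => vk.
  have <- : #|[set p | T p == v]| = true.
    by rewrite (tableau_fibre n k.+1) // leqW.
  apply: eq_card => p; rewrite !inE ffunE.
  case: leqP => // kT; rewrite -!val_eqE /=.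
  by rewrite ltn_eqF // gtn_eqF // (leq_ltn_trans vk kT).
apply: eq_card0 => p; rewrite !inE ffunE; apply/eqP=> E.
by move: vk; rewrite -E; case: (leqP (T p) k) => //; rewrite leqNgt => /negbTE->.
Qed.

Section Extend.
Variables (n k : nat) (T : filling n) (p : 'I_n * 'I_n).
Hypotheses (kn : (k < n)%N) (tabT : tableau_upto k T) (addp : addable T p).

Lemma extendE q : extend k T p q = (if q == p then k.+1 else T q) :> nat.
Proof. by rewrite ffunE; case: eqP => // _; rewrite inordK. Qed.

Lemma entry_addable : T p = 0%N :> nat.
Proof. by have /andP[+ _] := addp; rewrite /box negbK => /eqP. Qed.

Lemma box_extend q : box (extend k T p) q = (q == p) || box T q.
Proof. by rewrite /box extendE; case: (q =P p). Qed.

Lemma extend_tableau : tableau_upto k.+1 (extend k T p).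
Proof.
have [_ /forallP addq] := andP addp.
have Tle := tableau_entry_le n k T tabT.
apply/tableau_uptoP; split.
  move=> q s; rewrite !box_extend !extendE.
  have [->|sp] := eqVneq s p; have [->|qp] := eqVneq q p => //= sq.
  - move=> Tq; have /andP[] := tableau_down n k T tabT q p sq Tq.
    by rewrite /box entry_addable.
  - rewrite (leqW (Tle s)) andbT => _.
    by have /implyP -> := addq s; rewrite // sq.
  - exact: (tableau_down n k T tabT).
move=> v v0; case: (ltngtP v k.+1) => vk.
- have <- : #|[set p | T p == v]| = true.
    by rewrite (tableau_fibre n k) // -ltnS vk.
  apply: eq_card => q; rewrite !inE -!val_eqE /= extendE.
  case: (q =P p) => // ->; rewrite entry_addable.
  by rewrite gtn_eqF // ltn_eqF.
- apply: eq_card0 => q; rewrite !inE -val_eqE /= extendE.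
  case: (q =P p) => _; first by rewrite ltn_eqF.
  by rewrite ltn_eqF // (leq_ltn_trans (Tle q)) // ltnW.
transitivity #|[set p]|; last by rewrite cards1.
apply: eq_card => q; rewrite !inE -val_eqE /= extendE vk.
by case: (q =P p); rewrite ?eqxx // ltn_eqF // ltnS.
Qed.

Lemma truncate_extend i : (i <= k)%N -> truncate (extend k T p) i = truncate T i.
Proof.
move=> ik; apply/ffunP=> q; apply/val_inj; rewrite !ffunE.
have [->|//] := eqVneq q p.
by rewrite entry_addable leq0n inordK // leqNgt ltnS ik /= entry_addable.
Qed.

Lemma column_of_extend i :
  (0 < i <= k)%N -> column_of (extend k T p) i = column_of T i.
Proof.
case/andP=> i0 ik; rewrite /column_of; congr (if _ is Some _ then _ else _).
apply: eq_pick => q; rewrite /= box_extend extendE.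
have [->|//] := eqVneq q p.
by rewrite /box entry_addable /= gtn_eqF.
Qed.

Lemma column_of_extend_last : column_of (extend k T p) k.+1 = p.2.+1.
Proof.
rewrite /column_of; case: pickP => [q /andP[_]|/(_ p)].
  rewrite extendE; case: (q =P p) => [->//|_] /eqP Tq.
  by have := tableau_entry_le n k T tabT q; rewrite Tq ltnn.
by rewrite box_extend extendE !eqxx.
Qed.

Lemma sigma_extend i : (0 < i <= k)%N -> sigma (extend k T p) i = sigma T i.
Proof.
move=> ik; have /andP[_ le_ik] := ik.
by rewrite /sigma column_of_extend // truncate_extend.
Qed.

Lemma row_len_extend r : row_len (extend k T p) r = grow (row_len T) p.1 r.
Proof.
rewrite /row_len /grow !card_set_sum.
rewrite (eq_bigr (fun c => (box T (r, c) + ((r, c) == p))%N)); last first.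
  move=> c _; rewrite box_extend; case: eqP => [->|]; rewrite ?addn0 //.
  by rewrite /box entry_addable.
rewrite big_split /=; congr (_ + _)%N.
rewrite (bigD1 p.2) //= big1 ?addn0.
  by rewrite [X in _ == X]surjective_pairing xpair_eqE eqxx andbT.
by move=> c /negbTE; case: p => a b /= cb; rewrite xpair_eqE cb andbF.
Qed.

Lemma col_len_extend c :
  col_len (extend k T p) c = (col_len T c + (p.2.+1 == c))%N.
Proof.
rewrite /col_len !card_set_sum.
rewrite (eq_bigr (fun q => ((box T q && (q.2.+1 == c)%N)
    + ((q == p) && (p.2.+1 == c)%N))%N)); last first.
  move=> q _; rewrite box_extend; case: eqP => [->|]; rewrite ?addn0 //.
  by rewrite {2}/box entry_addable.
rewrite big_split /=; congr (_ + _)%N.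
by rewrite (bigD1 p) //= eqxx big1 ?addn0 // => q /negbTE->.
Qed.

End Extend.

Lemma col_lenE n k (T : filling n) (c : 'I_n) : tableau_upto k T ->
  col_len T c.+1 = (\sum_r (c < row_len T r))%N.
Proof.
move=> tabT; rewrite /col_len card_set_sum.
transitivity (\sum_r \sum_d (box T (r, d) && (d.+1 == c.+1)))%N.
  by rewrite pair_bigA; apply: eq_bigr => -[].
apply: eq_bigr => r _; rewrite (bigD1 c) //= eqxx andbT big1 ?addn0.
  by rewrite (box_row_len n k).
by move=> d dc; rewrite eqSS val_eqE (negbTE dc) andbF.
Qed.

(** A corner of the complement of a shape lies just behind the end of a row,
    and the row below it, if any, is strictly longer. *)
Lemma addableE n k (T : filling n) p : tableau_upto k T ->
  addable T p = first_row (row_len T) p.1 && (p.2 == row_len T p.1 :> nat).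
Proof.
move=> tabT; have boxE := box_row_len n k T tabT.
case: p => r c; rewrite /addable boxE /= -leqNgt; apply/andP/andP.
  case=> rc /forallP add; have cr : c = row_len T r :> nat.
    apply/eqP; rewrite eqn_leq rc andbT leqNgt; apply/negP => lt.
    pose d := Ordinal (ltn_trans lt (ltn_ord c)).
    have /implyP := add (r, d).
    rewrite boxE ltnn /southwest /= leqnn (ltnW lt) xpair_eqE eqxx -val_eqE /=.
    by rewrite ltn_eqF // => /(_ isT).
  split; last exact/eqP.
  apply/forallP=> s; apply/implyP=> sr.
  have /implyP := add (s, c).
  rewrite boxE /southwest /= leqnn (ltnW sr) xpair_eqE -val_eqE /= ltn_eqF //.
  by move=> /(_ isT); rewrite cr => /gtn_eqF->.
case=> /forallP r1 /eqP cr; rewrite cr leqnn; split=> //.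
apply/forallP=> -[s d]; rewrite boxE /southwest /= cr -andbA; apply/implyP.
case/and3P=> sr dc; case: (ltngtP s r) sr => // [sr _ _|/val_inj-> _].
  apply: leq_ltn_trans dc _; rewrite ltn_neqAle.
  rewrite (row_len_antitone n k T tabT s r (ltnW sr)) andbT.
  by rewrite eq_sym; have /implyP := r1 s; apply.
by rewrite xpair_eqE eqxx /= -val_eqE /= cr ltn_neqAle dc andbT.
Qed.

(** The difference of the lengths of two consecutive columns is the number of
    rows that end between them, so the box sorting index of the last entry is
    the number of rows as long as the one it was added to. For a box in the
    first column the n rows of the grid play the role of a column preceding
    the first one; the index then involves k + 1 where the number of empty rows
    involves n, whence the correction term. *)
Lemma sigma_extend_last n k (T : filling n) p :
    (k < n)%N -> tableau_upto k T -> addable T p ->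
  sigma (extend k T p) k.+1 =
    (multiplicity (row_len T) (row_len T p.1))%:Z
      + (if row_len T p.1 == 0%N then k.+1%:Z - n%:Z else 0).
Proof.
move=> kn tabT addp.
have Tfull : truncate (extend k T p) k.+1 = extend k T p.
  apply/ffunP=> q; rewrite [LHS]ffunE.
  by rewrite (tableau_entry_le n k.+1) // extend_tableau.
rewrite /sigma column_of_extend_last // Tfull !col_len_extend //.
have := addableE n k T p tabT; rewrite addp => /esym/andP[_ /eqP <-].
rewrite /multiplicity card_set_sum; case Ep: p.2 => [[|c] lt_cn] /=.
  rewrite (col_lenE n k T (Ordinal lt_cn) tabT) /=.
  have : (\sum_(r < n) (0 < row_len T r) + \sum_(r < n) (row_len T r == 0))%N = n.
    rewrite -big_split -[RHS]card_ord -sum1_card /=.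
    by apply: eq_bigr => r _; case: (row_len T r).
  move: (\sum_(r < n) _)%N (\sum_(r < n) _)%N => a b; lia.
rewrite !col_len_extend // Ep (col_lenE n k T (Ordinal lt_cn) tabT) /=.
rewrite (col_lenE n k T (Ordinal (ltnW lt_cn)) tabT) /=.
rewrite eqxx eqSS gtn_eqF //.
have : (\sum_(r < n) (c < row_len T r) =
  \sum_(r < n) (c.+1 < row_len T r) + \sum_(r < n) (row_len T r == c.+1))%N.
  rewrite -big_split /=; apply: eq_bigr => r _.
  by case: (ltngtP c.+1 (row_len T r)).
move: (\sum_(r < n) _)%N (\sum_(r < n) _)%N (\sum_(r < n) _)%N => x y z; lia.
Qed.

(** Each tableau of size k + 1 arises exactly once by adding the box of the
    entry k + 1 to a tableau of size k, namely to its truncation. *)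
Lemma sum_tableau_upto (V : nmodType) n k (F : filling n -> V) : (k < n)%N ->
  \sum_(T | tableau_upto k.+1 T) F T =
    \sum_(T | tableau_upto k T) \sum_(p | addable T p) F (extend k T p).
Proof.
move=> kn.
rewrite (partition_big (fun T => truncate T k) (tableau_upto k)) /=; last first.
  exact: truncate_tableau.
apply: eq_bigr => T tabT.
have Tle := tableau_entry_le n k T tabT.
have inj : {in addable T &, injective (extend k T)}.
  move=> p q _ _ /ffunP/(_ p)/(congr1 val) /=; rewrite !extendE // eqxx.
  by case: eqP => // _ E; have := Tle p; rewrite -E ltnn.
rewrite -(big_imset _ inj); apply: eq_bigl => T'; apply/andP/imsetP.
  case=> tabT' /eqP TT'.
  have /cards1P[p /setP Ep] : #|[set p | T' p == inord k.+1]| == 1%N.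
    by rewrite (tableau_fibre n k.+1 T' tabT') ?inordK // leqnn.
  have pE q : (T' q == k.+1 :> nat) = (q == p).
    by have := Ep q; rewrite !inE -val_eqE /= inordK.
  have T'p : T' p = k.+1 :> nat by apply/eqP; rewrite pE.
  have TE q : T q = (if q == p then 0%N else T' q) :> nat.
    rewrite -TT' ffunE -pE; case: (leqP (T' q) k) => qk; first by rewrite ltn_eqF.
    by rewrite eqn_leq (tableau_entry_le n k.+1 T' tabT' q) qk.
  exists p.
    rewrite unfold_in /box TE eqxx /=; apply/forallP=> q; apply/implyP.
    case/andP=> qp neq; rewrite TE (negbTE neq).
    by have /andP[] := tableau_down n k.+1 T' tabT' p q qp ltac:(by rewrite /box T'p).
  apply/ffunP=> q; apply/val_inj; rewrite /= extendE // TE.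
  by case: eqP => // ->.
case=> p addp ->; rewrite extend_tableau //; split=> //.
rewrite truncate_extend //; apply/eqP/ffunP=> q; rewrite ffunE.
by rewrite Tle.
Qed.

Lemma sum_addable (V : nmodType) n k (T : filling n) (G : 'I_n -> V) :
    (k < n)%N -> tableau_upto k T ->
  \sum_(p | addable T p) G p.1 = \sum_(r | first_row (row_len T) r) G r.
Proof.
move=> kn tabT.
rewrite (eq_bigl _ _ (fun p => addableE n k T p tabT)).
rewrite -(pair_big_dep _ (fun r c : 'I_n => c == row_len T r :> nat) (fun r _ => G r)) /=.
apply: eq_bigr => r _.
have lt : (row_len T r < n)%N.
  exact: leq_ltn_trans (row_len_le n k T tabT r (ltnW kn)) kn.
exact: (big_pred1 (Ordinal lt)).
Qed.

(** * The recurrence *)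

Definition tableau_sum (n k : nat) : {poly int} :=
  \sum_(T : filling n | tableau_upto k T)
    (\prod_(1 <= i < k.+1) sigma T i)%:P * row_prod (row_len T).

Lemma tableau_sum0 n : tableau_sum n 0 = 1.
Proof.
rewrite /tableau_sum (big_pred1 ([ffun=> ord0] : filling n)).
  rewrite big_geq // mul1r /row_prod big1 // => r _.
  suff -> : row_len [ffun=> ord0] r = 0%N by rewrite ffact_poly0.
  by apply: eq_card0 => c; rewrite !inE /box ffunE.
move=> T; apply/idP/eqP=> [tabT|->].
  apply/ffunP=> p; apply/val_inj; rewrite ffunE /=.
  by apply/eqP; rewrite -leqn0 (tableau_entry_le n 0).
apply/tableau_uptoP; split=> [p q _|v v0]; first by rewrite /box ffunE.
by rewrite leqNgt v0; apply: eq_card0 => p; rewrite !inE ffunE -val_eqE /= ltn_eqF.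
Qed.

Lemma row_prod_grow_empty n (lam : 'I_n -> nat) r : lam r = 0%N ->
  row_prod (grow lam r) = (1 + 'X) * row_prod lam.
Proof.
move=> r0; rewrite /row_prod (bigD1 r) //= [in RHS](bigD1 r) //= /grow eqxx r0.
rewrite ffact_polyS ffact_poly0 mul1r mulr1 mul1r; congr (_ * _).
by apply: eq_bigr => s /negbTE->; rewrite addn0.
Qed.

(** With the multiplicities of row lengths as weights, the sum over addable
    boxes is the sum over all n rows, that is x^2 d/dx of the product over rows
    plus n (1 + x) times that product. The correction of the box sorting index
    in the first column enters exactly once and turns the factor n into
    k + 1. *)
Lemma sum_addable_weight n k (T : filling n) :
    (k < n)%N -> tableau_upto k T ->
  \sum_(p | addable T p)
      (sigma (extend k T p) k.+1)%:P * row_prod (row_len (extend k T p)) =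
    k.+1%:R * (1 + 'X) * row_prod (row_len T)
      + 'X^2 * (row_prod (row_len T))^`().
Proof.
move=> kn tabT; set lam := row_len T.
(* The correction term of the box sorting index of an entry put in an empty row. *)
pose d := k.+1%:R - n%:R : {poly int}.
pose G r := row_prod (grow lam r) *+ multiplicity lam (lam r)
  + (if lam r == 0%N then d * (1 + 'X) * row_prod lam else 0).
transitivity (\sum_(p | addable T p) G p.1).
  apply: eq_bigr => p addp; rewrite sigma_extend_last // -/lam.
  rewrite [row_prod (row_len _)](eq_bigr (fun r => ffact_poly (grow lam p.1 r)));
    last first.
    by move=> r _; rewrite row_len_extend.
  rewrite -/(row_prod _) /G polyCD mulrDl -mulr_natl -natz polyC_natr; congr (_ + _).
  case: eqP => [p0|_]; last by rewrite mul0r.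
  by rewrite row_prod_grow_empty // polyCB -!natz !polyC_natr mulrA.
rewrite (sum_addable _ n k) // big_split /= -sum_first_row; last exact: row_prod_grow.
rewrite -big_mkcondr sum_first_row_eq; last exact: (exists_empty_row n k).
by rewrite deriv_row_prod /d; ring.
Qed.

Lemma tableau_sumS n k : (k < n)%N ->
  tableau_sum n k.+1 =
    k.+1%:R * (1 + 'X) * tableau_sum n k + 'X^2 * (tableau_sum n k)^`().
Proof.
move=> kn; rewrite /tableau_sum sum_tableau_upto // raddf_sum !mulr_sumr -big_split.
apply: eq_bigr => T tabT /=.
rewrite derivM derivC mul0r add0r [in RHS]mulrCA [in X in _ + X]mulrCA -mulrDr.
rewrite -sum_addable_weight // mulr_sumr; apply: eq_bigr => p addp.
rewrite mulrA -polyCM big_nat_recr //=; congr (_%:P * _); congr (_ * _).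
by apply: eq_big_nat => i ik; rewrite sigma_extend.
Qed.

Lemma tableau_sum_ramanujan n k : (k <= n)%N -> tableau_sum n k = ramanujan k.+1.
Proof.
elim: k => [|k IHk] kn; first exact: tableau_sum0.
by rewrite tableau_sumS // IHk // ltnW.
Qed.

(** Grouping the rows of the grid by length: the empty ones contribute factors
    f_0 = 1, so the product may start at length 1. *)
Lemma prod_ffact_poly_w n (T : filling n) :
  \prod_(1 <= i < n.+1) ffact_poly i ^+ w T i = row_prod (row_len T).
Proof.
have len_le r : (row_len T r < n.+1)%N.
  by rewrite ltnS (leq_trans (max_card _)) ?card_ord.
rewrite [RHS](partition_big (fun r => Ordinal (len_le r)) xpredT) //=.
rewrite big_ord_recl /= [X in _ = X * _]big1 ?mul1r; last first.
  by move=> r /eqP/(congr1 val) /= ->; rewrite ffact_poly0.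
rewrite big_add1 big_mkord; apply: eq_bigr => i _.
rewrite (eq_bigr (fun=> ffact_poly i.+1)); last by move=> r /eqP/(congr1 val) /= ->.
by rewrite prodr_const /w cardsE; congr (_ ^+ _); apply: eq_card.
Qed.

Theorem theorem30 (n : nat) (hn : (1 <= n)%N) :
  ramanujan n.+1 =
    \sum_(T in SYT n)
      \prod_(1 <= i < n.+1)
        ((sigma T i)%:P *
         (\sum_(0 <= j < i.+1) ('C(i, j) * j`!)%:R *: 'X^j) ^+ w T i).
Proof.
rewrite -(tableau_sum_ramanujan n n) //; apply: eq_big => T.
  by rewrite SYT_tableau_upto.
by move=> _; rewrite big_split /= -prod_ffact_poly_w rmorph_prod.
Qed.
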